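(* Let $x_0\in\mathbb{R}^{N_x}$ have at least one nonzero entry. Suppose that (1) there exists some $\Phi\in\mathbb{R}^{N_\Phi\times N_x}$ that satisfies both $Z_{AB}\Phi=\begin{bmatrix} I\\0\end{bmatrix}$ and $\Phi\in\mathcal{L}$, and (2) $\operatorname{rank}\bigl(Z_h X (I-F^\dagger F)\bigr)=N_uT$. Then localized MPC attains optimal global performance for the state $x_0$, i.e. $f^*=f^*_{\mathcal{L}}$.
   Context: Fix integers $N_x,N_u,T\ge 1$ and real matrices $A\in\mathbb{R}^{N_x\times N_x}$, $B\in\mathbb{R}^{N_x\times N_u}$, defining the system $x(t+1)=Ax(t)+Bu(t)$. Put $N_\Phi:=N_x(T+1)+N_uT$. Matrix $Z_{AB}$: $Z_{AB}:=\begin{bmatrix} I-Z\hat A & -Z\hat B\end{bmatrix}\in\mathbb{R}^{N_x(T+1)\times N_\Phi}$, where $Z$ is the block-downshift matrix (identity blocks $I_{N_x}$ on the first block sub-diagonal, zeros elsewhere), $\hat A=\operatorname{blkdiag}(A,\dots,A)$, $\hat B=\operatorname{blkdiag}(B,\dots,B)$ with compatible dimensions. Explicitly, applied to a vector $(x_0,\dots,x_T,u_0,\dots,u_{T-1})$ with $x_t\in\mathbb{R}^{N_x}$, $u_t\in\mathbb{R}^{N_u}$, $Z_{AB}$ gives the vector whose block $0$ is $x_0$ and whose block $t$ is $x_t-Ax_{t-1}-Bu_{t-1}$ for $t=1,\dots,T$. The matrix $\begin{bmatrix} I\\0\end{bmatrix}\in\mathbb{R}^{N_x(T+1)\times N_x}$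 has top block $I_{N_x}$ and zeros below. Decision variable: $\Phi=\begin{bmatrix}\Phi_x\\ \Phi_u\end{bmatrix}\in\mathbb{R}^{N_\Phi\times N_x}$, where $\Phi_x$ has $N_x(T+1)$ rows and $\Phi_u$ has $N_uT$ rows. Locality constraint: $\mathcal{L}\subseteq\mathbb{R}^{N_\Phi\times N_x}$ is the set of all matrices with a prescribed sparsity pattern, i.e. there is a fixed set $S$ of positions $(i,j)$ such that $\Phi\in\mathcal{L}$ iff $(\Phi)_{i,j}=0$ for every $(i,j)\notin S$. MPC problems: let $f(\mathbf{x},\mathbf{u})=\sum_{t=0}^{T-1}f_t(x_t,u_t)+f_T(x_T)$, where the $f_t$ and $f_T$ are closed, proper, convex functions with minimum at the origin, and let $\mathcal{X}=\mathcal{X}_0\times\dots\times\mathcal{X}_T$, $\mathcal{U}=\mathcal{U}_0\times\dots\times\mathcal{U}_{T-1}$ be products of closed convex sets containing the origin. The global MPC problem for state $x_0$ is: minimize $f(\Phi_xx_0,\Phi_ux_0)$ over $\Phi$ subject to $Z_{AB}\Phi=\begin{bmatrix} I\\0\end{bmatrix}$, $\Phi_xx_0\in\mathcal{X}$, $\Phi_ux_0\in\mathcal{U}$; its optimal value is $f^*$. The localized MPC problem is the same problem with the additional constraint $\Phi\in\mathcal{L}$; its optimal value is $f^*_{\mathcal{L}}$. ''Localized MPC attains optimal global performance'' for $x_0$ means $f^*=f^*_{\mathcal{L}}$ (here $f$ is an arbitrary objective of the form $\sum_{t=0}^{T-1}f_t(x_t,u_t)+f_T(x_T)$ with closed, proper,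 convex $f_t$, $f_T$ having their minimum at the origin, and $\mathcal{X},\mathcal{U}$ are arbitrary products of closed convex sets containing the origin). Further notation: $M^\dagger$ is the Moore–Penrose pseudoinverse. $(M)_{i:,:}$ denotes the rows of $M$ from the $i$-th on; $(M)_{\mathfrak{R},:}$ the submatrix of rows indexed by $\mathfrak{R}$. $\vec{M}$ is the column-stacking vectorization. For a matrix $M$, $M^{\mathrm{blk}}:=\operatorname{blkdiag}(M,\dots,M)$ with $N_x$ copies. $X=X(x_0):=\begin{bmatrix}(x_0)_1I&(x_0)_2I&\cdots&(x_0)_{N_x}I\end{bmatrix}$ with $I=I_{N_\Phi}$, so $X\in\mathbb{R}^{N_\Phi\times N_\Phi N_x}$ and $\Lambda x_0=X\vec{\Lambda}$ for $\Lambda\in\mathbb{R}^{N_\Phi\times N_x}$. $Z_p:=(Z_{AB}^\dagger)_{N_x+1:,:}\begin{bmatrix} I\\0\end{bmatrix}$, $Z_h:=(I-Z_{AB}^\dagger Z_{AB})_{N_x+1:,:}$. $\mathfrak{L}$ (constrained vector indices) is the set of indices of the vector $\vec{\Phi_2}$, where $\Phi_2:=(\Phi)_{N_x+1:,:}$, whose entries are constrained to be zero by $\Phi\in\mathcal{L}$. $F:=(Z_h^{\mathrm{blk}})_{\mathfrak{L},:}$. *)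

(* Defs.v *)
From HB Require Import structures.
From mathcomp Require Import all_boot all_order all_algebra.
From mathcomp Require Import all_classical all_reals all_analysis.

Set Implicit Arguments.
Unset Strict Implicit.
Unset Printing Implicit Defensive.

Import Order.TTheory GRing.Theory Num.Theory.
Import numFieldNormedType.Exports.

Local Open Scope classical_set_scope.
Local Open Scope ring_scope.

Section MoorePenrose.
Context {R : realType}.

Definition penrose m n (M : 'M[R]_(m, n)) (N : 'M[R]_(n, m)) : Prop :=
  [/\ M *m N *m M = M, N *m M *m N = N,
      (M *m N)^T = M *m N & (N *m M)^T = N *m M].

(* The value given by [xget] satisfies the Penrose equations by [mpinvP],
   and is the only matrix that does by [penrose_uniq]. *)
Definition mpinv m n (M : 'M[R]_(m, n)) : 'M[R]_(n, m) :=
  xget 0 [set N | penrose M N].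

Lemma penrose_uniq m n (M : 'M[R]_(m, n)) N1 N2 :
  penrose M N1 -> penrose M N2 -> N1 = N2.
Proof.
move=> [a1 b1 c1 d1] [a2 b2 c2 d2].
have E1 : M *m N1 = M *m N2.
  rewrite -c1 -{1}a2 -(mulmxA (M *m N2)) trmx_mul c1 c2 mulmxA.
  by rewrite a1.
have E2 : N1 *m M = N2 *m M.
  rewrite -d1 -{1}a2 -(mulmxA M) mulmxA trmx_mul d1 d2 -mulmxA.
  by rewrite (mulmxA M) a1.
by rewrite -b1 -mulmxA E1 mulmxA E2 b2.
Qed.

Lemma row_free_gram_unit m n (M : 'M[R]_(m, n)) :
  row_free M -> M *m M^T \in unitmx.
Proof.
move=> fM; rewrite -row_free_unit -kermx_eq0; apply/eqP/row_matrixP => i.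
rewrite row0; set u := row i _.
have uMM : u *m (M *m M^T) = 0.
  by apply/sub_kermxP; rewrite /u row_sub.
have uM0 : u *m M = 0.
  have h : (u *m M) *m (u *m M)^T = 0.
    by rewrite trmx_mul mulmxA -(mulmxA u) uMM mul0mx.
  have /matrixP/(_ 0 0) := h; rewrite !mxE => /eqP.
  rewrite psumr_eq0; last by move=> j _; rewrite [_^T _ _]mxE -expr2 sqr_ge0.
  move=> /allP h0; apply/rowP => j; rewrite [RHS]mxE.
  have := h0 j (mem_index_enum _).
  by rewrite [_^T _ _]mxE -expr2 sqrf_eq0 => /eqP.
by have /(row_free_inj fM) : u *m M = 0 *m M by rewrite uM0 mul0mx.
Qed.

Lemma mpinvP m n (M : 'M[R]_(m, n)) : penrose M (mpinv M).
Proof.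
rewrite /mpinv; case: xgetP => [N -> //|noN]; exfalso.
have := (mulmx_base M, row_base_free M, col_base_full M).
move: (\rank M) (col_base M) (row_base M) => r C W [[/esym CW fW] fC].
have uW : W *m W^T \in unitmx by exact: row_free_gram_unit.
have uC : C^T *m C \in unitmx.
  rewrite -{2}(trmxK C); apply: row_free_gram_unit.
  by rewrite /row_free mxrank_tr.
pose P := W^T *m invmx (W *m W^T); pose Q := invmx (C^T *m C) *m C^T.
have WP : W *m P = 1%:M by rewrite mulmxA mulmxV.
have QC : Q *m C = 1%:M by rewrite -mulmxA mulVmx.
have sP : (P *m W)^T = P *m W.
  by rewrite /P !trmx_mul trmx_inv trmx_mul trmxK !mulmxA.
have sQ : (C *m Q)^T = C *m Q.
  by rewrite /Q !trmx_mul trmx_inv trmx_mul trmxK !mulmxA.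
have E1 : M *m (P *m Q) = C *m Q.
  by rewrite CW mulmxA -(mulmxA C) WP mulmx1.
have E2 : (P *m Q) *m M = P *m W.
  by rewrite CW mulmxA -(mulmxA P) QC mulmx1.
apply: (noN (P *m Q)); split.
- by rewrite E1 CW -mulmxA (mulmxA Q) QC mul1mx.
- by rewrite E2 -mulmxA (mulmxA W) WP mul1mx.
- by rewrite E1 sQ.
- by rewrite E2 sP.
Qed.

End MoorePenrose.

Section Matrices.
Context {R : realType}.

Lemma row_from_subproof i m (k : 'I_(m - i)) : (i + k < m)%N.
Proof. by rewrite -ltn_subRL. Qed.

(* [rows_from i M] drops the first [i] rows. *)
Definition rows_from (K : Type) i m n (M : 'M[K]_(m, n)) : 'M[K]_(m - i, n) :=
  rowsub (fun k => Ordinal (row_from_subproof k)) M.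

Definition rows_in m n (I : {set 'I_m}) (M : 'M[R]_(m, n)) : 'M[R]_(#|I|, n) :=
  rowsub (fun k : 'I_#|I| => enum_val k) M.

Definition blkdiag k m n (M : 'M[R]_(m, n)) :
    'M[R]_(\sum_(i < k) m, \sum_(j < k) n) :=
  \mxblock_(i < k, j < k) (if i == j then M else 0).

(* Column stacking; [mxvec] of the library stacks rows. *)
Definition vec (K : Type) m n (M : 'M[K]_(m, n)) : 'cV[K]_(\sum_(j < n) m) :=
  \mxcol_(j < n) col j M.

Definition Xmx (N : nat) n (x0 : 'cV[R]_n) : 'M[R]_(N, \sum_(j < n) N) :=
  \mxrow_(j < n) (x0 j 0)%:M.

Lemma Xmx_vec N n (x0 : 'cV[R]_n) (L : 'M[R]_(N, n)) :
  Xmx N x0 *m vec L = L *m x0.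
Proof.
rewrite /Xmx /vec mul_mxrow_mxcol; apply/colP => i.
rewrite summxE mxE; apply: eq_bigr => j _.
by rewrite mul_scalar_mx !mxE mulrC.
Qed.

End Matrices.

Notation nPhi nx nu T :=
  (\sum_(t < T.+1) nx + \sum_(t < T) nu)%N (only parsing).

Section System.
Context {R : realType} {nx nu T : nat}.

Definition downshift : 'M[R]_(\sum_(t < T.+1) nx) :=
  \mxblock_(s < T.+1, t < T.+1) (if s == t.+1 :> nat then 1%:M else 0 : 'M[R]_nx).

Definition Ahat (A : 'M[R]_nx) : 'M[R]_(\sum_(t < T.+1) nx) := blkdiag T.+1 A.

(* [T] copies of [B] on the diagonal, and a last block row equal to zero so
   that the product with [downshift] makes sense. *)
Definition Bhat (B : 'M[R]_(nx, nu)) :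
    'M[R]_(\sum_(t < T.+1) nx, \sum_(t < T) nu) :=
  \mxblock_(s < T.+1, t < T) (if s == t :> nat then B else 0).

Definition ZAB (A : 'M[R]_nx) (B : 'M[R]_(nx, nu)) :
    'M[R]_(\sum_(t < T.+1) nx, nPhi nx nu T) :=
  row_mx (1%:M - downshift *m Ahat A) (- (downshift *m Bhat B)).

Definition I0 : 'M[R]_(\sum_(t < T.+1) nx, nx) :=
  \mxcol_(t < T.+1) (if t == 0 then 1%:M else 0 : 'M[R]_nx).

Lemma submxcol_downshift0 n (Y : 'M[R]_(\sum_(t < T.+1) nx, n)) :
  submxcol (downshift *m Y) 0 = 0.
Proof.
rewrite -[Y]submxcolK mul_mxblock_mxrow mxcolK big1// => t _.
by rewrite mul0mx.
Qed.

Lemma submxcol_downshiftS n (Y : 'M[R]_(\sum_(t < T.+1) nx, n)) (t : 'I_T) :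
  submxcol (downshift *m Y) (lift ord0 t) = submxcol Y (widen_ord (leqnSn T) t).
Proof.
rewrite -{1}[Y]submxcolK mul_mxblock_mxrow mxcolK.
rewrite (bigD1 (widen_ord (leqnSn T) t))//= eqxx mul1mx big1 ?addr0// => s st.
rewrite eqSS ifN ?mul0mx//.
by apply: contraNneq st => ts; apply/eqP/val_inj => /=.
Qed.

Lemma submxcol_Ahat n A (Y : 'M[R]_(\sum_(t < T.+1) nx, n)) (t : 'I_T.+1) :
  submxcol (Ahat A *m Y) t = A *m submxcol Y t.
Proof.
rewrite -{1}[Y]submxcolK mul_mxblock_mxrow mxcolK.
rewrite (bigD1 t)//= eqxx big1 ?addr0// => s st.
by rewrite eq_sym (negbTE st) mul0mx.
Qed.

Lemma submxcol_Bhat n B (Y : 'M[R]_(\sum_(t < T) nu, n)) (t : 'I_T) :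
  submxcol (Bhat B *m Y) (widen_ord (leqnSn T) t) = B *m submxcol Y t.
Proof.
rewrite -{1}[Y]submxcolK mul_mxblock_mxrow mxcolK.
rewrite (bigD1 t)//= eqxx big1 ?addr0// => s st.
rewrite ifN ?mul0mx// eq_sym.
by apply: contraNneq st => ts; apply/eqP/val_inj.
Qed.

Lemma submxcol_ZAB0 n A B (Y : 'M[R]_(\sum_(t < T.+1) nx, n)) V :
  submxcol (ZAB A B *m col_mx Y V) 0 = submxcol Y 0.
Proof.
rewrite mul_row_col mulmxBl mul1mx mulNmx -!mulmxA.
by rewrite submxcolD submxcolB submxcolN !submxcol_downshift0 !subr0.
Qed.

Lemma submxcol_ZABS n A B (Y : 'M[R]_(\sum_(t < T.+1) nx, n)) V (t : 'I_T) :
  submxcol (ZAB A B *m col_mx Y V) (lift ord0 t) =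
  submxcol Y (lift ord0 t) - A *m submxcol Y (widen_ord (leqnSn T) t)
    - B *m submxcol V t.
Proof.
rewrite mul_row_col mulmxBl mul1mx mulNmx -!mulmxA.
rewrite submxcolD submxcolB submxcolN !submxcol_downshiftS.
by rewrite submxcol_Ahat submxcol_Bhat.
Qed.

Definition Zh A B : 'M[R]_(nPhi nx nu T - nx, nPhi nx nu T) :=
  rows_from nx (1%:M - mpinv (ZAB A B) *m ZAB A B).

(* [S] is the set of positions at which a matrix is allowed to be nonzero. *)
Definition locality (S : {set 'I_(nPhi nx nu T) * 'I_nx}) :
    set 'M[R]_(nPhi nx nu T, nx) :=
  [set Phi | forall i j, (i, j) \notin S -> Phi i j = 0].

(* The matrix of booleans [constrained] has the shape of [Phi]; it is stacked
   in the same way as [Phi] to obtain the indices of [vec Phi_2]. *)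
Definition frakL (S : {set 'I_(nPhi nx nu T) * 'I_nx}) :
    {set 'I_(\sum_(j < nx) (nPhi nx nu T - nx))} :=
  let constrained := \matrix_(i, j) ((i, j) \notin S) in
  [set k | vec (rows_from nx constrained) k 0]%SET.

Definition Fmx A B (S : {set 'I_(nPhi nx nu T) * 'I_nx}) :=
  rows_in (frakL S) (blkdiag nx (Zh A B)).

End System.

Section ConvexFunctions.
Context {R : realType} {V : normedModType R}.

Definition epigraph (f : V -> \bar R) : set (V * R^o) :=
  [set z | (f z.1 <= z.2%:E)%E].

Definition proper_fun (f : V -> \bar R) : Prop :=
  (forall v, f v != -oo%E) /\ exists v, f v != +oo%E.

(* A closed function is a function whose epigraph is closed. *)
Definition mpc_cost_fun (f : V -> \bar R) : Prop :=
  [/\ closed (epigraph f), proper_fun f, convex_set (epigraph f)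
    & forall v, (f 0%R <= f v)%E].

Definition mpc_constraint_set (C : set V) : Prop :=
  [/\ closed C, convex_set C & C 0].

End ConvexFunctions.

Section MPC.
Context {R : realType} {nx nu T : nat}.

Definition mpc_cost (f : 'I_T -> 'cV[R]_nx * 'cV[R]_nu -> \bar R)
    (fT : 'cV[R]_nx -> \bar R)
    (x : 'cV[R]_(\sum_(t < T.+1) nx)) (u : 'cV[R]_(\sum_(t < T) nu)) : \bar R :=
  (\sum_(t < T) f t (submxcol x (widen_ord (leqnSn T) t), submxcol u t)
   + fT (submxcol x ord_max))%E.

Definition global_feasible (A : 'M[R]_nx) (B : 'M[R]_(nx, nu))
    (X : 'I_T.+1 -> set 'cV[R]_nx) (U : 'I_T -> set 'cV[R]_nu)
    (x0 : 'cV[R]_nx) : set 'M[R]_(nPhi nx nu T, nx) :=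
  [set Phi | [/\ ZAB A B *m Phi = I0,
    forall t, X t (submxcol (usubmx Phi *m x0) t)
    & forall t, U t (submxcol (dsubmx Phi *m x0) t)]].

(* Optimal value over a feasible set [D]; it is [+oo] when [D] is empty. *)
Definition optimal_value (f : 'I_T -> 'cV[R]_nx * 'cV[R]_nu -> \bar R)
    (fT : 'cV[R]_nx -> \bar R) (x0 : 'cV[R]_nx)
    (D : set 'M[R]_(nPhi nx nu T, nx)) : \bar R :=
  ereal_inf
    [set mpc_cost f fT (usubmx Phi *m x0) (dsubmx Phi *m x0) | Phi in D].

Definition global_value A B f fT X U x0 : \bar R :=
  optimal_value f fT x0 (global_feasible A B X U x0).

Definition localized_value A B S f fT X U x0 : \bar R :=
  optimal_value f fT x0 (global_feasible A B X U x0 `&` locality S).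

End MPC.

(* Main.v *)
Require Import Defs.
From HB Require Import structures.
From mathcomp Require Import all_boot all_order all_algebra.
From mathcomp Require Import all_classical all_reals all_analysis.

Import Order.TTheory GRing.Theory Num.Theory.
Import numFieldNormedType.Exports.

Local Open Scope classical_set_scope.
Local Open Scope ring_scope.

(* A solution of [ZAB *m M = 0] has zero initial state and is determined by its
   inputs, so the projection [P] onto the kernel of [ZAB] has rank at most
   [nu * T] and no information is lost in [Zh] by dropping the top rows of [P].
   Adding [P *m L] to a local solution [Psi] preserves locality as soon as
   [F *m vec L = 0], that is, for [vec L] in the range of [1 - F^+ F].  The rank
   condition says that the vectors [P *m L *m x0] for such [L] fill the kernel
   of [ZAB]; hence every trajectory [Phi *m x0] is the trajectory of a local
   solution, and the two problems have the same attainable costs. *)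

(** The columns of [C *m D] are combinations of those of [C], so the rank bound makes the two column
    spaces equal. Transposing turns them into row spaces, the setting of [submx]. *)
Lemma mulmx_range {F : fieldType} {m n p q}
    (C : 'M[F]_(m, n)) (D : 'M[F]_(n, p)) (d : 'M[F]_(n, q)) :
  (\rank C <= \rank (C *m D))%N -> exists w, C *m D *m w = C *m d.
Proof.
move=> rkC; have sCD : ((C *m D)^T <= C^T)%MS by rewrite trmx_mul submxMl.
have /submxP[w dw] : ((C *m d)^T <= (C *m D)^T)%MS.
  rewrite trmx_mul (submx_trans (submxMl _ _))//.
  by rewrite -(geq_leqif (mxrank_leqif_sup sCD)) !mxrank_tr.
by exists w^T; apply: trmx_inj; rewrite trmx_mul trmxK dw.
Qed.

Lemma vecE {K : Type} {m n} (M : 'M[K]_(m, n)) (i : 'I_m) (j : 'I_n) :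
  vec M (tagnat.Rank j i) 0 = M i j.
Proof.
by have /colP/(_ i) := mxcolK (fun j => col j M) j; rewrite !mxE.
Qed.

Lemma vec_surj {K : Type} {m n} (w : 'cV[K]_(\sum_(j < n) m)) :
  exists M : 'M[K]_(m, n), vec M = w.
Proof.
exists (\matrix_(i, j) submxcol w j i 0).
rewrite -[RHS]submxcolK; apply/mxcolP => j; rewrite !mxcolK.
by apply/colP => i; rewrite !mxE.
Qed.

Lemma blkdiag_vec {R : realType} {m n k} (M : 'M[R]_(m, n)) (N : 'M[R]_(n, k)) :
  blkdiag k M *m vec N = vec (M *m N).
Proof.
rewrite mul_mxblock_mxrow; apply/mxcolP => j; rewrite !mxcolK.
rewrite (bigD1 j)//= eqxx big1 ?addr0 => [|s sj]; first by rewrite !colE mulmxA.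
by rewrite eq_sym (negbTE sj) mul0mx.
Qed.

Section rows_from.
Context {R : realType} {i m n : nat}.

Lemma rows_fromM p (M : 'M[R]_(m, n)) (N : 'M[R]_(n, p)) :
  rows_from i (M *m N) = rows_from i M *m N.
Proof. by rewrite /rows_from mul_rowsub_mx. Qed.

(** The index [k'] is chosen before [K]: [Fmx_vec] uses it both for the boolean matrix behind
    [frakL] and for a real matrix. *)
Lemma rows_fromE (k : 'I_m) : (i <= k)%N ->
  exists k' : 'I_(m - i), forall K (N : 'M[K]_(m, n)) j,
    rows_from i N k' j = N k j.
Proof.
move=> ik; have k'P : (k - i < m - i)%N by rewrite ltn_sub2r// (leq_ltn_trans ik).
exists (Ordinal k'P) => K N j; rewrite mxE; congr (N _ _).
by apply/val_inj; rewrite /= subnKC.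
Qed.

End rows_from.

Section kernel.
Context {R : realType} {nx nu T : nat} (A : 'M[R]_nx) (B : 'M[R]_(nx, nu)).
Local Notation Z := (@ZAB R nx nu T A B).
Local Notation P := (1%:M - mpinv Z *m Z).

Lemma mulZAB_proj : Z *m P = 0.
Proof. by case: (mpinvP Z) => ZZ _ _ _; rewrite mulmxBr mulmx1 mulmxA ZZ subrr. Qed.

Lemma proj_ker n (M : 'M[R]_(_, n)) : Z *m M = 0 -> P *m M = M.
Proof. by move=> ZM; rewrite mulmxBl mul1mx -mulmxA ZM mulmx0 subr0. Qed.

Lemma ker_top0 n (M : 'M[R]_(nPhi nx nu T, n)) (i : 'I__) j :
  Z *m M = 0 -> (i < nx)%N -> M i j = 0.
Proof.
move=> ZM ix; have : submxcol (usubmx M) 0 = 0.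
  by rewrite -(submxcol_ZAB0 A B _ (dsubmx M)) vsubmxK ZM submxcol0.
move=> /matrixP/(_ (Ordinal ix) j); rewrite !mxE => <-; congr (M _ _).
(* The offset of block 0 is an empty sum. *)
by apply/val_inj; rewrite [RHS]tagnat.RankEsum/= big_pred0_eq.
Qed.

Lemma ker_rows_from0 n (M : 'M[R]_(nPhi nx nu T, n)) :
  Z *m M = 0 -> rows_from nx M = 0 -> M = 0.
Proof.
move=> ZM M0; apply/matrixP => i j; rewrite [RHS]mxE.
have [ix|xi] := ltnP i nx; first exact: ker_top0.
by have [k <-] := @rows_fromE nx _ n i xi; rewrite M0 mxE.
Qed.

(** With zero initial state and zero inputs, the recursion [x(t+1) = A x(t) + B u(t)] keeps all
    states at zero, by induction on time. *)
Lemma ker_dsubmx0 n (M : 'M[R]_(nPhi nx nu T, n)) :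
  Z *m M = 0 -> dsubmx M = 0 -> M = 0.
Proof.
move=> ZM M0; rewrite -[M]vsubmxK M0 -[X in col_mx X]submxcolK.
suff x0 t : submxcol (usubmx M) t = 0.
  rewrite -col_mx0; congr col_mx.
  by apply/mxcolP => t; rewrite mxcolK x0 submxcol0.
rewrite -[M]vsubmxK M0 in ZM; case: t => t; elim: t => [|t IH] tT.
  rewrite (_ : Ordinal tT = 0); last exact/val_inj.
  by rewrite -(submxcol_ZAB0 A B _ 0) ZM submxcol0.
have tT' : (t < T)%N by [].
have := submxcol_ZABS A B (usubmx M) 0 (Ordinal tT').
rewrite ZM !submxcol0 mulmx0 subr0.
rewrite (_ : widen_ord _ _ = Ordinal (ltnW tT)); last exact/val_inj.
rewrite IH mulmx0 subr0 => /esym; rewrite (_ : lift _ _ = Ordinal tT)//.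
exact/val_inj.
Qed.

(** Since [Z *m P = 0], a matrix that annihilates the input rows [dsubmx P] from the right
    annihilates all of [P]. So these [nu * T] rows span the row space of [P]. *)
Lemma rank_proj : (\rank P <= nu * T)%N.
Proof.
have dP : (P <= dsubmx P)%MS.
  rewrite submxE; apply/eqP; apply: ker_dsubmx0.
    by rewrite mulmxA mulZAB_proj mul0mx.
  by rewrite -mul_dsub_mx mulmx_coker.
apply: leq_trans (mxrankS dP) (leq_trans (rank_leq_row _) _).
by rewrite sum_nat_const card_ord mulnC.
Qed.

Lemma rank_Zh : (\rank (Zh A B : 'M[R]_(_, nPhi nx nu T)) <= nu * T)%N.
Proof.
apply: leq_trans rank_proj; rewrite /Zh /rows_from rowsubE.
exact: mxrankM_maxr.
Qed.

(** The first [nx] rows of [P *m L] vanish in any case. The others are stacked in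
    [blkdiag nx (Zh A B) *m vec L], from which [Fmx A B S] selects the entries that have to be
    zero. *)
Lemma Fmx_vec S (L : 'M[R]_(nPhi nx nu T, nx)) :
  Fmx A B S *m vec L = 0 -> locality S (P *m L).
Proof.
move=> FL i j ijS; have [ix|xi] := ltnP i nx.
  by apply: ker_top0; rewrite // mulmxA mulZAB_proj mul0mx.
have [k kE] := @rows_fromE nx _ nx i xi.
have kL : tagnat.Rank j k \in frakL S by rewrite inE vecE kE mxE.
rewrite -kE -vecE rows_fromM -blkdiag_vec.
have := FL; rewrite /Fmx /rows_in mul_rowsub_mx.
move=> /matrixP/(_ (enum_rank_in kL (tagnat.Rank j k)) 0).
by rewrite [LHS]mxE enum_rankK_in// => ->; rewrite mxE.
Qed.

Lemma local_response S x0 (Phi Psi : 'M[R]_(nPhi nx nu T, nx)) :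
  \rank (Zh A B *m Xmx (nPhi nx nu T) x0
         *m (1%:M - mpinv (Fmx A B S) *m Fmx A B S)) = (nu * T)%N ->
  Z *m Phi = I0 -> Z *m Psi = I0 -> locality S Psi ->
  exists Psi', [/\ Z *m Psi' = I0, locality S Psi' & Psi' *m x0 = Phi *m x0].
Proof.
set F := Fmx A B S => rk ZPhi ZPsi SPsi.
set d := (Phi - Psi) *m x0.
have Zd : Z *m d = 0 by rewrite mulmxA mulmxBr ZPhi ZPsi subrr mul0mx.
(* The rank of [Zh A B] is at most [nu * T], and the product still attains this value, so both have
   the same range. *)
have [w wd] : exists w, Zh A B *m (Xmx (nPhi nx nu T) x0
    *m (1%:M - mpinv F *m F)) *m w = Zh A B *m d.
  by apply: mulmx_range; rewrite mulmxA rk rank_Zh.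
have [L Lw] := vec_surj ((1%:M - mpinv F *m F) *m w).
exists (Psi + P *m L); split.
- by rewrite mulmxDr mulmxA mulZAB_proj mul0mx addr0.
- have FL : F *m vec L = 0.
    have [FF _ _ _] := mpinvP F.
    by rewrite Lw mulmxA mulmxBr mulmx1 mulmxA FF subrr mul0mx.
  by move=> i j ijS; rewrite mxE SPsi// (Fmx_vec S)// addr0.
(* As [P] fixes [d], it is enough to compare the images of [L *m x0] and [d] under [P]; their lower
   rows agree by the choice of [w]. *)
- suff Pd : P *m (L *m x0 - d) = 0.
    have PL : P *m L *m x0 = d.
      by rewrite -[RHS]proj_ker// -mulmxA; apply/eqP; rewrite -subr_eq0 -mulmxBr Pd.
    by rewrite (mulmxDl Psi) PL /d mulmxBl addrC subrK.
  apply: ker_rows_from0; first by rewrite mulmxA mulZAB_proj mul0mx.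
  by rewrite rows_fromM -/(Zh A B) mulmxBr -wd -(Xmx_vec x0 L) Lw !mulmxA subrr.
Qed.

End kernel.

Theorem theorem2 (R : realType) (nx nu T : nat)
    (nx_gt0 : (0 < nx)%N) (nu_gt0 : (0 < nu)%N) (T_gt0 : (0 < T)%N)
    (A : 'M[R]_nx) (B : 'M[R]_(nx, nu))
    (S : {set 'I_(nPhi nx nu T) * 'I_nx})
    (f : 'I_T -> 'cV[R]_nx * 'cV[R]_nu -> \bar R)
    (fT : 'cV[R]_nx -> \bar R)
    (X : 'I_T.+1 -> set 'cV[R]_nx) (U : 'I_T -> set 'cV[R]_nu)
    (x0 : 'cV[R]_nx)
    (hf : forall t, mpc_cost_fun (f t)) (hfT : mpc_cost_fun fT)
    (hX : forall t, mpc_constraint_set (X t))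
    (hU : forall t, mpc_constraint_set (U t))
    (hx0 : exists i, x0 i 0 != 0)
    (hfeas : exists Phi : 'M[R]_(nPhi nx nu T, nx),
      ZAB A B *m Phi = I0 /\ locality S Phi)
    (hrank : \rank (Zh A B *m Xmx (nPhi nx nu T) x0
                    *m (1%:M - mpinv (Fmx A B S) *m Fmx A B S))
             = (nu * T)%N) :
  global_value A B f fT X U x0 = localized_value A B S f fT X U x0.
Proof.
case: hfeas => Psi [ZPsi SPsi].
rewrite /global_value /localized_value /optimal_value; congr ereal_inf.
apply/seteqP; split=> [_ [Phi [ZPhi XPhi UPhi] <-]|_ [Phi [DPhi _] <-]]; last first.
  by exists Phi.
(* Cost and constraints on states and inputs see [Phi] only through [Phi *m x0], so [Psi'] can
   replace it. *)
have [Psi' [ZPsi' SPsi' Psi'x0]] := local_response A B S x0 Phi Psi hrank ZPhi ZPsi SPsi.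
have ux0 : usubmx Psi' *m x0 = usubmx Phi *m x0 by rewrite !mul_usub_mx Psi'x0.
have dx0 : dsubmx Psi' *m x0 = dsubmx Phi *m x0 by rewrite !mul_dsub_mx Psi'x0.
exists Psi'; last by rewrite ux0 dx0.
by split=> //; split=> // t; rewrite ?ux0 ?dx0.
Qed.
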